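(* Let $\mathcal{M}_\varepsilon$, $\varepsilon>0$, be a one-parameter family of minimal surfaces in $\mathbb{T}_\varepsilon^2\times\mathbb{R}$, where $\mathbb{T}^2_\varepsilon$ is a horizontal flat $2$-torus, such that, as $\varepsilon\to 0$ and for any $H\in\mathbb{R}$, the translated surface $\mathcal{M}_\varepsilon-(0,0,H/\varepsilon^2)$ converges either to a doubly periodic Scherk surface or to a pair of vertical planes. Then - either the horizontal flat torus $\mathbb{T}^2_\varepsilon$ converges to a triangular lattice as $\varepsilon\to 0$, and the limit vertical planes have three possible directions, - or otherwise, the (limit) vertical planes alternate between two possible directions.
   Context: Doubly periodic Scherk surface: let $\mathbf{T}_1=(\cos\theta_1,\sin\theta_1)$ and $\mathbf{T}_2=(\cos\theta_2,\sin\theta_2)$ be linearly independent unit vectors, and let $\mathbb{T}^2$ be the flat torus $\mathbb{R}^2/\langle 2\pi\mathbf{T}_1,2\pi\mathbf{T}_2\rangle$. A doubly periodic Scherk surface is, after quotient by its periods, a minimal surface of genus $0$ in $\mathbb{T}^2\times\mathbb{R}$ with exactly four Scherk ends (ends asymptotic to vertical planes), two extending upwards and both parallel to $\mathbf{T}_1$, and two extending downwards and both parallel to $\mathbf{T}_2$. It is a minimal graph over $\{a\mathbf{T}_1+b\mathbf{T}_2 : (a,b)\in(0,\pi)^2\cup(\pi,2\pi)^2\}$ (modulo the lattice), taking the values $\pm\infty$ on the edges of the rhombi. Throughout, ''a doubly periodic Scherk surface in $\mathbb{T}^2\times\mathbb{R}$'' means only the surface of genus $0$ with four Scherk ends in the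 quotient; choosing a larger horizontal torus is not allowed. The Scherk surfaces appearing as limits are ordered by height, $\ldots,\mathcal{S}_k,\mathcal{S}_{k+1},\ldots$; between $\mathcal{S}_k$ and $\mathcal{S}_{k+1}$ the limit is a pair of vertical planes, parallel to the upward ends of $\mathcal{S}_k$ and to the downward ends of $\mathcal{S}_{k+1}$. ''Alternate between two possible directions'' means that the direction of the planes between $\mathcal{S}_k$ and $\mathcal{S}_{k+1}$ depends only on the parity of $k$. A triangular lattice is a planar lattice generated by two vectors of equal length at angle $\pi/3$. A flat torus is said to converge to a triangular lattice if its period lattice does. *)

(* Defs.v *)
From HB Require Import structures.
From mathcomp Require Import all_boot all_order all_algebra.
From mathcomp Require Import all_classical all_reals all_analysis.

Set Implicit Arguments.
Unset Strict Implicit.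
Unset Printing Implicit Defensive.

Import Order.TTheory GRing.Theory Num.Theory.
Import numFieldNormedType.Exports.

Local Open Scope classical_set_scope.
Local Open Scope ring_scope.

(* R^3 as horizontal plane times vertical axis. *)
Notation E3 R := ('rV[R]_2 * R)%type.

Section Geometry.
Variable R : realType.
Implicit Types (u v d c : 'rV[R]_2) (p q : E3 R) (L : set 'rV[R]_2).

Definition vec2 (a b : R) : 'rV[R]_2 := \row_(i < 2) (if i == 0 then a else b).

Definition unitvec (t : R) : 'rV[R]_2 := vec2 (cos t) (sin t).

Definition lin_indep u v : Prop := row_free (col_mx u v).

Definition parallel u v : Prop := exists2 k : R, k != 0 & u = k *: v.

Definition dot p q : R := (\sum_(i < 2) p.1 0 i * q.1 0 i) + p.2 * q.2.

(* A flat torus R^2 / L is represented by its period lattice L. *)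

Definition lattice u v : set 'rV[R]_2 :=
  [set x | exists a b : int, x = u *~ a + v *~ b].

Definition is_lattice L : Prop :=
  exists u v, lin_indep u v /\ L = lattice u v.

Definition is_triangular L : Prop :=
  exists r t : R, 0 < r /\
    L = lattice (r *: unitvec t) (r *: unitvec (t + pi / 3)).

(* Convergence, as e tends to 0 from above, in the space of lattices
   GL_2(R) / GL_2(Z): some bases converge to a basis. *)
Definition cvg_lattice (Lam : R -> set 'rV[R]_2) L : Prop :=
  exists (u v : R -> 'rV[R]_2) (u0 v0 : 'rV[R]_2),
    [/\ lin_indep u0 v0, L = lattice u0 v0,
        u e @[e --> 0^'+] --> u0, v e @[e --> 0^'+] --> v0 &
        \forall e \near 0^'+, Lam e = lattice (u e) (v e)].

Fixpoint iter_deriv (vs : seq 'rV[R]_2) (Y : 'rV[R]_2 -> E3 R) :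
    'rV[R]_2 -> E3 R :=
  if vs is v :: vs' then (fun x => 'D_v (iter_deriv vs' Y) x) else Y.

Definition smooth_on (D : set 'rV[R]_2) (Y : 'rV[R]_2 -> E3 R) : Prop :=
  forall (vs : seq 'rV[R]_2) (x : 'rV[R]_2), D x ->
    {for x, continuous (iter_deriv vs Y)} /\
    forall v, derivable (iter_deriv vs Y) x v.

(* A smooth regular parametrization Y of vanishing mean curvature.  With the
   first fundamental form E, F, G, the last clause says that
   e G - 2 f F + g E = 0 for the second fundamental form e, f, g computed with
   any normal vector n. *)
Definition minimal_patch (D : set 'rV[R]_2) (Y : 'rV[R]_2 -> E3 R) : Prop :=
  [/\ open D, smooth_on D Y &
    forall x, D x ->
      let e1 := vec2 1 0 in let e2 := vec2 0 1 in
      let Y1 := iter_deriv [:: e1] Y x in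
      let Y2 := iter_deriv [:: e2] Y x in
      let Y11 := iter_deriv [:: e1; e1] Y x in
      let Y12 := iter_deriv [:: e1; e2] Y x in
      let Y22 := iter_deriv [:: e2; e2] Y x in
      let E := dot Y1 Y1 in let F := dot Y1 Y2 in let G := dot Y2 Y2 in
      0 < E * G - F ^+ 2 /\
      forall n : E3 R, dot n Y1 = 0 -> dot n Y2 = 0 ->
        dot n Y11 * G - 2 * dot n Y12 * F + dot n Y22 * E = 0].

Definition congr_mod L p q : Prop := L (p.1 - q.1) /\ p.2 = q.2.

(* An immersed minimal surface Sg -> (R^2 / L) x R.  The map X picks a
   representative in R^3 of the image of each point of Sg, and need not be
   continuous: only its class modulo L matters.  Around each point, the map to
   the quotient lifts, in a topological chart phi of the surface Sg, to a
   minimal patch Y in R^3. *)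
Definition minimal_surface L (Sg : topologicalType) (X : Sg -> E3 R) :
    Prop :=
  [/\ hausdorff_space Sg, @second_countable Sg &
    forall s : Sg,
      exists (D : set 'rV[R]_2) (phi : 'rV[R]_2 -> Sg)
             (Y : 'rV[R]_2 -> E3 R),
      [/\ (phi @` D) s,
          {in D &, injective phi},
          (forall x, D x -> {for x, continuous phi}) /\
          (forall U, open U -> U `<=` D -> open (phi @` U)),
          minimal_patch D Y &
          forall x, D x -> congr_mod L (Y x) (X (phi x))]].

(* The preimage in R^3 of a surface in (R^2 / L) x R. *)
Definition periodic_lift L (Sg : Type) (X : Sg -> E3 R) : set (E3 R) :=
  [set p | exists s, congr_mod L p (X s)].

Definition shift_down (h : R) (M : set (E3 R)) : set (E3 R) :=
  [set p | M (p.1, p.2 + h)].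

(* Local Hausdorff (Painleve-Kuratowski) convergence as e tends to 0 from
   above.  It is implied by smooth convergence on compact sets, with any
   multiplicity. *)
Definition cvg_sets (A : R -> set (E3 R)) (S : set (E3 R)) : Prop :=
  (forall p, S p -> forall U, nbhs p U ->
     \forall e \near 0^'+, A e `&` U !=set0) /\
  (forall p, ~ S p -> exists2 U, nbhs p U &
     \forall e \near 0^'+, A e `&` U = set0).

(* Convergence of subsets A e of (R^2 / Lam e) x R, given by their preimages in
   R^3, to a subset of (R^2 / L) x R; this includes convergence of the tori. *)
Definition cvg_periodic (Lam : R -> set 'rV[R]_2) (A : R -> set (E3 R))
    L (S : set (E3 R)) : Prop :=
  cvg_lattice Lam L /\ cvg_sets A S.

Definition vertical_plane L c d : set (E3 R) :=
  [set p | exists l t, L l /\ p.1 = c + l + t *: d].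

(* Two distinct parallel planes of direction d in (R^2 / L) x R. *)
Definition plane_pair L d (P : set (E3 R)) : Prop :=
  exists c c', [/\ d != 0, vertical_plane L c d <> vertical_plane L c' d &
                   P = vertical_plane L c d `|` vertical_plane L c' d].

Definition scherk_lattice (t1 t2 : R) : set 'rV[R]_2 :=
  lattice ((2 * pi) *: unitvec t1) ((2 * pi) *: unitvec t2).

Definition sphere : set (E3 R) := [set p | dot p p = 1].

(* f identifies Sg with the sphere punctured at the four points q i:
   genus 0 and exactly four ends. *)
Definition four_punctured_sphere (Sg : topologicalType)
    (f : Sg -> E3 R) (q : 'I_4 -> E3 R) : Prop :=
  [/\ injective q /\ (forall i, sphere (q i)),
      injective f, range f = sphere `\` range q &
      forall U : set Sg, open U <->
        exists2 V : set (E3 R), open V & U = f @^-1` V].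

(* The end of X at the puncture q is asymptotic, modulo L, to the vertical
   half-plane over the line c + R d, going up if sg = 1, down if sg = -1. *)
Definition scherk_end L (Sg : Type) (X f : Sg -> E3 R) (q : E3 R)
    (sg : R) c d : Prop :=
  (forall e A : R, 0 < e -> \forall y \near q, forall s, f s = y ->
     A < sg * (X s).2 /\
     exists l t, L l /\ `|(X s).1 + l - (c + t *: d)| < e) /\
  (forall (e : R) V, 0 < e -> nbhs q V ->
     exists A : R, forall t z : R, A < sg * z ->
     exists s l, [/\ V (f s), L l &
       `|((X s).1 + l, (X s).2) - (c + t *: d, z)| < e]).

Definition rhombi (a b : R) : Prop :=
  ((0 < a < pi) && (0 < b < pi)) \/
  ((pi < a < 2 * pi) && (pi < b < 2 * pi)).

(* (a, b) are coordinates of a point in the relative interior of an edge along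
   which the first coordinate varies. *)
Definition edge (a b : R) : Prop :=
  (0 < a < pi /\ (b = 0 \/ b = pi)) \/
  (pi < a < 2 * pi /\ (b = pi \/ b = 2 * pi)).

(* S (a subset of R^3) is, modulo L, the closure of a minimal graph over the
   rhombi, translated horizontally by c, with values +oo on the edges parallel
   to the direction t1 of the upward ends, and -oo on the edges parallel to
   the direction t2 of the downward ends. *)
Definition graph_over_rhombi L (t1 t2 : R) (S : set (E3 R)) : Prop :=
  exists c (u : 'rV[R]_2 -> R),
    let pos a b := c + a *: unitvec t1 + b *: unitvec t2 in
    let D := [set x | exists a b, rhombi a b /\ x = pos a b] in
    [/\ minimal_patch D (fun x => (x, u x)),
        S = closure [set p | exists2 x, D x & congr_mod L p (x, u x)],
        (forall a b, edge a b -> u x @[x --> within D (nbhs (pos a b))] --> +oo) &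
        (forall a b, edge b a -> u x @[x --> within D (nbhs (pos a b))] --> -oo)].

(* S is the preimage in R^3 of a doubly periodic Scherk surface, up to
   translation, with upward ends parallel to unitvec t1 and downward ends
   parallel to unitvec t2. *)
Definition scherk_surface (t1 t2 : R) (S : set (E3 R)) : Prop :=
  let L := scherk_lattice t1 t2 in
  lin_indep (unitvec t1) (unitvec t2) /\
  exists (Sg : topologicalType) (X f : Sg -> E3 R)
         (q : 'I_4 -> E3 R) (c : 'I_4 -> 'rV[R]_2),
    [/\ minimal_surface L X /\ (forall s s', congr_mod L (X s) (X s') -> s = s'),
        S = periodic_lift L X,
        four_punctured_sphere f q,
        (forall i : 'I_4,
           if (i < 2)%N then scherk_end L X f (q i) 1 (c i) (unitvec t1)
           else scherk_end L X f (q i) (-1) (c i) (unitvec t2)) &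
        graph_over_rhombi L t1 t2 S].

(* Limits at height H / e^2 of a family M e of subsets of
    (R^2 / Lam e) x R, given by their preimages in R^3 *)

Definition rescaled_cvg (Lam : R -> set 'rV[R]_2) (M : R -> set (E3 R))
    (H : R) L (S : set (E3 R)) : Prop :=
  cvg_periodic Lam (fun e => shift_down (H / e ^+ 2) (M e)) L S.

Definition scherk_limit (Lam : R -> set 'rV[R]_2) (M : R -> set (E3 R))
    (H t1 t2 : R) : Prop :=
  exists2 S, scherk_surface t1 t2 S &
             rescaled_cvg Lam M H (scherk_lattice t1 t2) S.

Definition planes_limit (Lam : R -> set 'rV[R]_2) (M : R -> set (E3 R))
    (H : R) d : Prop :=
  exists L P, plane_pair L d P /\ rescaled_cvg Lam M H L P.

(* With I an interval of indices, H lies above height h k and below height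
   h (k + 1); if only one of k and k + 1 is in I, the stack ends there and only
   the corresponding inequality is required. *)
Definition between (I : set int) (h : int -> R) (k : int) (H : R) : Prop :=
  [/\ I k \/ I (k + 1), I k -> h k < H & I (k + 1) -> H < h (k + 1)].

End Geometry.

(* Main.v *)
Require Import Defs.
From HB Require Import structures.
From mathcomp Require Import all_boot all_order all_algebra.
From mathcomp Require Import all_classical all_reals all_analysis.
From mathcomp Require Import ring lra zify.

(** All the Scherk limits live over the same torus: a family of lattices has at
    most one limit ([cvg_lattice_unique]), so the lattices
    [scherk_lattice (up k) (down k)] coincide for all [k].  Divided by [2 pi],
    the end directions of every Scherk limit are therefore a basis of
    unit vectors of one fixed lattice.

    Let [p, q] be such a basis.  A basis vector of a lattice is primitive, and a
    short computation with the norm shows that the primitive unit vectors of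
    the lattice are, up to sign, [p] and [q], together with [p - q] or [p + q]
    when the scalar product of [p] and [q] is 1/2 or -1/2
    ([lattice_primitive_unit]).  Hence at most three directions ever occur
    ([unit_basis_three_directions]), and the third one occurs only if [p] and
    [q] make an angle of [pi / 3] or [2 pi / 3], in which case the lattice is
    triangular ([scherk_lattice_triangular]).

    If the limit lattice is not triangular, each Scherk limit has the same
    unordered pair of directions.  Consecutive limits share the direction
    of the planes between them, which is upward for the lower one and downward
    for the upper one.  So the two directions exchange their roles at
    each step, and the direction of the planes depends only on the parity of
    the index ([alternating_directions]). *)

Set Implicit Arguments.
Unset Strict Implicit.
Unset Printing Implicit Defensive.

Import Order.TTheory GRing.Theory Num.Theory.
Import numFieldNormedType.Exports.

Local Open Scope classical_set_scope.
Local Open Scope ring_scope.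

(** * Plane lattices *)

Section Plane.
Variable R : realType.
Implicit Types (u v w p q : 'rV[R]_2).

Definition dotp u v : R := u 0 0 * v 0 0 + u 0 1 * v 0 1.

Definition wedge u v : R := u 0 0 * v 0 1 - u 0 1 * v 0 0.

Lemma rV2P u v : u 0 0 = v 0 0 -> u 0 1 = v 0 1 -> u = v.
Proof.
move=> e0 e1; apply/rowP => i; case: (unliftP 0 i) => [j|] -> //.
by rewrite ord1 (_ : lift 0 0 = 1) //; exact: val_inj.
Qed.

Lemma det_mx2 (A : 'M[R]_2) : \det A = A 0 0 * A 1 1 - A 0 1 * A 1 0.
Proof.
have l00 : lift 0 0 = 1 :> 'I_2 by exact: val_inj.
have l10 : lift 1 0 = 0 :> 'I_2 by exact: val_inj.
rewrite (expand_det_row _ 0) big_ord_recl big_ord1 /cofactor !det_mx11 !mxE.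
by rewrite -[ord0]/(0 : 'I_2) !l00 l10 /=; ring.
Qed.

Lemma lin_indepE u v : lin_indep u v <-> wedge u v != 0.
Proof.
pose A : 'M[R]_2 := col_mx u v.
have A0 j : A 0 j = u 0 j.
  by rewrite -(col_mxEu u v 0 j); congr (A _ j); exact: val_inj.
have A1 j : A 1 j = v 0 j.
  by rewrite -(col_mxEd u v 0 j); congr (A _ j); exact: val_inj.
rewrite /lin_indep -[col_mx u v]/A row_free_unit unitmxE unitfE.
by rewrite det_mx2 !A0 !A1.
Qed.

Lemma lin_indep_sym u v : lin_indep u v -> lin_indep v u.
Proof.
rewrite !lin_indepE; apply: contra_neq => vu.
by rewrite -[LHS]opprK -[RHS]oppr0 -vu /wedge; ring.
Qed.

Lemma parallel_refl u : parallel u u.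
Proof. by exists 1; rewrite ?oner_neq0 ?scale1r. Qed.

Lemma parallel_sym u v : parallel u v -> parallel v u.
Proof.
case=> k k0 ->; exists k^-1; first by rewrite invr_neq0.
by rewrite scalerA mulVf // scale1r.
Qed.

Lemma parallel_trans v u w : parallel u v -> parallel v w -> parallel u w.
Proof.
case=> k k0 -> [l l0 ->]; exists (k * l); first by rewrite mulf_neq0.
by rewrite scalerA.
Qed.

Lemma parallel_lin_dep u v : parallel u v -> ~ lin_indep u v.
Proof.
case=> k _ ->; rewrite lin_indepE /wedge !mxE; apply/negP; rewrite negbK.
by apply/eqP; ring.
Qed.

Lemma mulrz_coordE u (a : int) i j : (u *~ a) i j = u i j * a%:~R.
Proof. by rewrite -scaler_int mxE mulrC. Qed.

Lemma lattice_scale (r : R) u v w : r != 0 ->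
  lattice (r *: u) (r *: v) (r *: w) <-> lattice u v w.
Proof.
move=> r0; split=> -[a [b e]]; exists a, b.
  by apply: (scalerI r0); rewrite e scalerDr !scalerMzr.
by rewrite e scalerDr !scalerMzr.
Qed.

Lemma lattice_scale_eq (r : R) u v u' v' : r != 0 ->
  lattice (r *: u) (r *: v) = lattice (r *: u') (r *: v') ->
  lattice u v = lattice u' v'.
Proof.
move=> r0 e; apply/seteqP; split=> w /(lattice_scale _ _ _ r0) hw;
  by apply/(lattice_scale _ _ _ r0); rewrite ?e // -e.
Qed.

Lemma lattice_l u v : lattice u v u.
Proof. by exists 1, 0; rewrite mulr1z mulr0z addr0. Qed.

Lemma lattice_r u v : lattice u v v.
Proof. by exists 0, 1; rewrite mulr1z mulr0z add0r. Qed.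

Lemma latticeD u v w w' :
  lattice u v w -> lattice u v w' -> lattice u v (w + w').
Proof.
move=> [a [b ->]] [a' [b' ->]]; exists (a + a'), (b + b').
by rewrite !mulrzDr addrACA.
Qed.

Lemma latticeMz u v w (a : int) : lattice u v w -> lattice u v (w *~ a).
Proof.
move=> [b [c ->]]; exists (b * a), (c * a).
by rewrite mulrzDl !mulrzA.
Qed.

Lemma lattice_sub p q u v :
  lattice u v p -> lattice u v q -> lattice p q `<=` lattice u v.
Proof. by move=> hp hq _ [a [b ->]]; apply: latticeD; apply: latticeMz. Qed.

Lemma lattice_eq p q u v : lattice u v p -> lattice u v q ->
  lattice p q u -> lattice p q v -> lattice p q = lattice u v.
Proof. by move=> *; apply/seteqP; split; apply: lattice_sub. Qed.

(** Each of the two changes of basis has an integer determinant, and the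
    determinants multiply to 1 because they compare the areas of the same two
    parallelograms; hence each is 1 or -1. *)
Lemma lattice_basis_unimodular u v u' v' : lin_indep u v ->
    lattice u v = lattice u' v' ->
  exists a b c d : int,
    [/\ u' = u *~ a + v *~ b, v' = u *~ c + v *~ d &
        (a * d - b * c) ^+ 2 = 1].
Proof.
move=> /lin_indepE uv e.
have : lattice u v u' by rewrite e; exact: lattice_l.
have : lattice u v v' by rewrite e; exact: lattice_r.
have : lattice u' v' u by rewrite -e; exact: lattice_l.
have : lattice u' v' v by rewrite -e; exact: lattice_r.
move=> [c' [d' ev]] [a' [b' eu]] [c [d ev']] [a [b eu']].
exists a, b, c, d; split=> //.
suff /intUnitRing.unitzPl : (a' * d' - b' * c') * (a * d - b * c) = 1.
  by rewrite qualifE => /orP[] /eqP ->.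
apply: (@intr_inj R); apply: (mulIf uv).
have w1 : wedge u v = (a' * d' - b' * c')%:~R * wedge u' v'.
  by rewrite {1}eu {1}ev /wedge !mxE !mulrz_coordE; ring.
have w2 : wedge u' v' = (a * d - b * c)%:~R * wedge u v.
  by rewrite {1}eu' {1}ev' /wedge !mxE !mulrz_coordE; ring.
by rewrite intrM -mulrA -w2 -w1 mul1r.
Qed.

(** Let [c = dotp p q], [s = a + b] and [d = a - b].  The condition on the norm
    of [w] is [s^2 (1 + c) + d^2 (1 - c) = 2], with [-1 < c < 1].  If [s] and
    [d] are nonzero, both squares are at least 1, so both are 1 and
    one of [a] and [b] vanishes: [w] is [p] or [q] up to sign.  If [s] or [d]
    vanishes, then primitivity forces [a] and [b] to be 1 or -1, and the
    condition reads [2 c = 1] or [2 c = -1]. *)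
Lemma lattice_primitive_unit p q w (a b : int) :
    dotp p p = 1 -> dotp q q = 1 -> lin_indep p q ->
    w = p *~ a + q *~ b -> coprimez a b -> dotp w w = 1 ->
  [\/ parallel w p, parallel w q,
      2 * dotp p q = 1 /\ parallel w (p - q) |
      2 * dotp p q = - 1 /\ parallel w (p + q)].
Proof.
move=> pp qq /lin_indepE pq ew cab ww.
set c := dotp p q.
have lag : c ^+ 2 + wedge p q ^+ 2 = 1.
  by rewrite -[RHS]mulr1 -{1}pp -qq /c /dotp /wedge; ring.
have c1 : c ^+ 2 < 1 by rewrite -lag ltrDl exprn_even_gt0.
have norm : a%:~R ^+ 2 + b%:~R ^+ 2 + 2 * a%:~R * b%:~R * c = 1 :> R.
  transitivity (a%:~R ^+ 2 * dotp p p + b%:~R ^+ 2 * dotp q q +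
                2 * a%:~R * b%:~R * c).
    by rewrite pp qq !mulr1.
  by rewrite -[RHS]ww ew /c /dotp !mxE !mulrz_coordE; ring.
have par0 (k : int) v : k ^+ 2 = 1 -> w = v *~ k -> parallel w v.
  move=> k1 ->; exists k%:~R; last by rewrite scaler_int.
  by rewrite intr_eq0; lia.
have [a0|a0] := eqVneq a 0.
  apply: Or42; apply: (par0 b); last by rewrite ew a0 mulr0z add0r.
  by move: cab; rewrite a0 /coprimez gcd0z; lia.
have [b0|b0] := eqVneq b 0.
  apply: Or41; apply: (par0 a); last by rewrite ew b0 mulr0z addr0.
  by move: cab; rewrite b0 /coprimez gcdz0; lia.
have [ab|ab] := eqVneq a b.
  have a1 : a ^+ 2 = 1 by move: cab; rewrite -ab /coprimez gcdzz; lia.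
  have a1R : a%:~R ^+ 2 = 1 :> R by rewrite -rmorphXn /= a1.
  apply: Or44; split; first by move: norm; rewrite -ab; nra.
  by apply: (par0 a) => //; rewrite ew -ab mulrzDl.
have [ab'|ab'] := eqVneq a (- b).
  have b1 : b ^+ 2 = 1 by move: cab; rewrite ab' /coprimez gcdNz gcdzz; lia.
  have b1R : b%:~R ^+ 2 = 1 :> R by rewrite -rmorphXn /= b1.
  apply: Or43; split; first by move: norm; rewrite ab' rmorphN; nra.
  by apply: (par0 (- b)); rewrite ?sqrrN // ew ab' mulrzDl !mulrNz mulNrz opprK.
exfalso.
have ge1 (k : int) : k != 0 -> 1 <= k%:~R ^+ 2 :> R.
  by move=> k0; rewrite -rmorphXn /= ler1z; nia.
have s1 : 1 <= (a + b)%:~R ^+ 2 :> R by apply: ge1; lia.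
have d1 : 1 <= (a - b)%:~R ^+ 2 :> R by apply: ge1; lia.
have c2 : 0 < 1 + c by nra.
have c3 : 0 < 1 - c by nra.
have sum0 : ((a + b)%:~R ^+ 2 - 1) * (1 + c) +
            ((a - b)%:~R ^+ 2 - 1) * (1 - c) = 0.
  transitivity (2 * (a%:~R ^+ 2 + b%:~R ^+ 2 + 2 * a%:~R * b%:~R * c - 1)).
    by ring.
  by rewrite norm subrr mulr0.
have s2 : (a + b)%:~R ^+ 2 = 1 :> R by nra.
have d2 : (a - b)%:~R ^+ 2 = 1 :> R by nra.
have : (a + b) ^+ 2 = (a - b) ^+ 2.
  by apply: (@intr_inj R); rewrite !rmorphXn /= s2 d2.
nia.
Qed.

End Plane.

(** * Uniqueness of the limit of a family of lattices *)

Section Limits.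
Variable R : realType.
Implicit Types (u v w p q : 'rV[R]_2) (Lam : R -> set 'rV[R]_2).

Lemma cvg_intr T (F : set_system T) (FF : ProperFilter F) (f : T -> R) (x : R) :
    f t @[t --> F] --> x -> (\forall t \near F, exists n : int, f t = n%:~R) ->
  exists n : int, x = n%:~R.
Proof.
move=> fx fint.
have approx (e : R) : 0 < e -> exists n : int, `|x - n%:~R| < e.
  move=> e0; have xe : \forall t \near F, `|x - f t| < e.
    exact: cvgr_dist_lt fx e e0.
  have [t [[n fn] xt]] := filter_ex (filterI fint xe).
  by exists n; rewrite -fn.
have half : 0 < 2^-1 :> R by rewrite invr_gt0.
have [n xn] := approx _ half; exists n.
apply/eqP; rewrite -subr_eq0 -normr_le0; apply/ler_addgt0Pl => e e0.
have min0 : 0 < Num.min e 2^-1 by rewrite lt_min e0.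
have [m xm] := approx _ min0.
move: xm; rewrite lt_min => /andP[xe xm].
suff -> : n = m by rewrite addr0 ltW.
have : `|(n - m)%:~R| < 1 :> R.
  have -> : (n - m)%:~R = (x - m%:~R) - (x - n%:~R) :> R by ring.
  by rewrite (le_lt_trans (ler_normB _ _)) //; lra.
by rewrite -intr_norm ltrz1; lia.
Qed.

Lemma cvg_wedge (F : set_system R) (FF : Filter F) (u v : R -> 'rV[R]_2) u0 v0 :
  u e @[e --> F] --> u0 -> v e @[e --> F] --> v0 ->
  wedge (u e) (v e) @[e --> F] --> wedge u0 v0.
Proof.
have coord (w : R -> 'rV[R]_2) w0 j :
    w e @[e --> F] --> w0 -> w e 0 j @[e --> F] --> w0 0 j.
  by move=> ww; exact: (cvg_comp _ _ ww (@coord_continuous _ _ _ 0 j w0)).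
by move=> uu vv; apply: cvgB; apply: cvgM; apply: coord.
Qed.

(** By Cramer's rule, the coordinates of [w e] in the basis [u e, v e] are
    quotients of wedge products, so they converge to the coordinates of the
    limit [w0] in the limit basis.  Being integers, they have integer limits. *)
Lemma lattice_limit Lam (u v w : R -> 'rV[R]_2) u0 v0 w0 : lin_indep u0 v0 ->
    u e @[e --> 0^'+] --> u0 -> v e @[e --> 0^'+] --> v0 ->
    w e @[e --> 0^'+] --> w0 ->
    (\forall e \near 0^'+, Lam e = lattice (u e) (v e)) ->
    (\forall e \near 0^'+, Lam e (w e)) ->
  lattice u0 v0 w0.
Proof.
move=> /lin_indepE uv0 uu vv ww Le we.
have uv : wedge (u e) (v e) @[e --> 0^'+] --> wedge u0 v0 by exact: cvg_wedge.
have uvn0 : \forall e \near 0^'+, wedge (u e) (v e) != 0.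
  by apply: cvgr_neq0 uv uv0.
have coef (x y : R -> 'rV[R]_2) x0 y0 :
    x e @[e --> 0^'+] --> x0 -> y e @[e --> 0^'+] --> y0 ->
    (\forall e \near 0^'+, exists n : int,
       wedge (x e) (y e) = n%:~R * wedge (u e) (v e)) ->
    exists n : int, wedge x0 y0 / wedge u0 v0 = n%:~R.
  move=> xx yy xy.
  have lim : wedge (x e) (y e) / wedge (u e) (v e) @[e --> 0^'+] -->
      wedge x0 y0 / wedge u0 v0.
    by apply: cvgM; [exact: cvg_wedge | exact: cvgV].
  apply: cvg_intr lim _; apply: filterS2 xy uvn0 => e [n ->] n0.
  by exists n; rewrite mulfK.
have [a ea] := coef w v w0 v0 ww vv ltac:(
  by apply: filterS2 Le we => e -> [a [b ->]]; exists a;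
     rewrite /wedge !mxE !mulrz_coordE; ring).
have [b eb] := coef u w u0 w0 uu ww ltac:(
  by apply: filterS2 Le we => e -> [a' [b ->]]; exists b;
     rewrite /wedge !mxE !mulrz_coordE; ring).
exists a, b; apply: rV2P; rewrite !mxE !mulrz_coordE -ea -eb;
  apply: (mulIf uv0); rewrite mulrDl !mulrA !mulfVK // /wedge; ring.
Qed.

Lemma cvg_lattice_unique Lam L L' :
  cvg_lattice Lam L -> cvg_lattice Lam L' -> L = L'.
Proof.
move=> [u [v [u0 [v0 [i -> uu vv Le]]]]].
move=> [u' [v' [u0' [v0' [i' -> uu' vv' Le']]]]].
apply: lattice_eq.
- apply: (lattice_limit i' uu' vv' uu Le').
  by apply: filterS Le => e ->; exact: lattice_l.
- apply: (lattice_limit i' uu' vv' vv Le').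
  by apply: filterS Le => e ->; exact: lattice_r.
- apply: (lattice_limit i uu vv uu' Le).
  by apply: filterS Le' => e ->; exact: lattice_l.
- apply: (lattice_limit i uu vv vv' Le).
  by apply: filterS Le' => e ->; exact: lattice_r.
Qed.

End Limits.

(** * Unit bases of rhombic lattices *)

Section Rhombic.
Variable R : realType.
Implicit Types (u v w p q : 'rV[R]_2).

Lemma cos_pi3 : cos (pi / 3) = 2^-1 :> R.
Proof.
have pi0 := pi_gt0 R.
set y : R := pi / 3.
have c0 : 0 < cos y.
  by apply: cos_gt0_pihalf; rewrite /y; apply/andP; split; lra.
(* The triple angle formula makes [cos y] a root of
   [4 X^3 - 3 X + 1 = (X + 1) (2 X - 1)^2]. *)
have : cos (y + (y + y)) = - 1 by rewrite -cospi /y; congr cos; lra.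
rewrite !cosD sinD => e.
have s2 := cos2Dsin2 y.
have /eqP : (cos y + 1) * (2 * cos y - 1) ^+ 2 = 0.
  transitivity (cos y * (cos y * cos y - sin y * sin y) -
      sin y * (sin y * cos y + cos y * sin y) + 1 +
      3 * cos y * (cos y ^+ 2 + sin y ^+ 2 - 1)); first by ring.
  by rewrite e s2; ring.
rewrite mulf_eq0 expf_eq0 /= => /orP[|] /eqP; lra.
Qed.

Lemma dotp_unitvec (s t : R) : dotp (unitvec s) (unitvec t) = cos (t - s).
Proof. by rewrite /dotp !mxE /= cosB; ring. Qed.

Lemma dotp_unitvec1 (t : R) : dotp (unitvec t) (unitvec t) = 1.
Proof. by rewrite dotp_unitvec subrr cos0. Qed.

Lemma latticeC u v : lattice u v = lattice v u.
Proof.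
by apply/seteqP; split=> _ [a [b ->]]; exists b, a; rewrite addrC.
Qed.

Lemma lattice_oppr u v : lattice u (- v) = lattice u v.
Proof.
by apply/seteqP; split=> _ [a [b ->]]; exists a, (- b);
  rewrite mulrNz mulNrz ?opprK.
Qed.

Lemma scherk_lattice_triangular (s t : R) :
  2 * dotp (unitvec s) (unitvec t) = 1 \/
  2 * dotp (unitvec s) (unitvec t) = - 1 ->
  is_triangular (scherk_lattice s t).
Proof.
(* Adding pi to [t] negates the second generator, which preserves the lattice
   and changes the sign of the scalar product. *)
wlog half : t / 2 * dotp (unitvec s) (unitvec t) = 1 => [hwlog|_].
  case=> half; first by apply: hwlog => //; left.
  have opp : unitvec (t + pi) = - unitvec t.
    by apply: rV2P; rewrite !mxE /= ?cosDpi ?sinDpi.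
  suff -> : scherk_lattice s t = scherk_lattice s (t + pi).
    have half' : 2 * dotp (unitvec s) (unitvec (t + pi)) = 1.
      by move: half; rewrite opp /dotp !mxE /=; lra.
    by apply: hwlog => //; left.
  by rewrite /scherk_lattice opp scalerN lattice_oppr.
have pi0 := pi_gt0 R.
have r0 : 0 < 2 * pi :> R by lra.
set y : R := pi / 3.
have cy : cos (t - s) = cos y.
  by move: half; rewrite dotp_unitvec cos_pi3; lra.
have /eqP : sin (t - s) ^+ 2 = sin y ^+ 2 by rewrite !sin2cos2 cy.
have rotate (z x x' : R) : cos x = cos x' -> sin x = sin x' ->
    unitvec (z + x) = unitvec (z + x').
  by move=> ec es; apply: rV2P; rewrite !mxE /= ?cosD ?sinD ec es.
rewrite eqf_sqr => /orP[] /eqP sy.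
  exists (2 * pi), s; split=> //; congr (lattice _ (_ *: _)).
  by rewrite -(rotate _ (t - s)) // addrC subrK.
exists (2 * pi), t; split=> //; rewrite /scherk_lattice latticeC.
congr (lattice _ (_ *: _)).
rewrite -(rotate _ (- (t - s))) ?cosN ?sinN ?sy ?opprK //.
by congr unitvec; ring.
Qed.

Lemma lattice_unit_basis p q w w' :
    dotp p p = 1 -> dotp q q = 1 -> lin_indep p q ->
    dotp w w = 1 -> lattice p q = lattice w w' ->
  [\/ parallel w p, parallel w q,
      2 * dotp p q = 1 /\ parallel w (p - q) |
      2 * dotp p q = - 1 /\ parallel w (p + q)].
Proof.
move=> pp qq pq ww e.
have [a [b [c [d [ew _ un]]]]] := lattice_basis_unimodular pq e.
apply: (lattice_primitive_unit pp qq pq ew) => //.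
(* The determinant is its own inverse, so it turns the expansion of the
   determinant along its first row into a Bezout relation. *)
apply/coprimezP; exists (d * (a * d - b * c), - c * (a * d - b * c)) => /=.
by rewrite -un; ring.
Qed.

(** The third direction depends only on the basis [p, q], so that it serves all
    the unit bases of the lattice simultaneously. *)
Lemma unit_basis_three_directions p q :
    dotp p p = 1 -> dotp q q = 1 -> lin_indep p q ->
  exists r, [/\ lin_indep p r, lin_indep q r &
    forall w w', dotp w w = 1 -> lattice p q = lattice w w' ->
      [\/ parallel w p, parallel w q | parallel w r]].
Proof.
move=> pp qq pq.
(* The exceptional unit vectors are [p - q] when the scalar product is 1/2 and
   [p + q] when it is -1/2, so its sign decides which of them can occur. *)
exists (if 0 < dotp p q then p - q else p + q); split.
- move: pq; rewrite !lin_indepE; apply: contra_neq.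
  by case: ifP => _; rewrite /wedge !mxE; lra.
- move: pq; rewrite !lin_indepE; apply: contra_neq.
  by case: ifP => _; rewrite /wedge !mxE; lra.
move=> w w' ww /(lattice_unit_basis pp qq pq ww)[wp|wq|[c wr]|[c wr]].
- exact: Or31.
- exact: Or32.
- by apply: Or33; rewrite ifT //; lra.
- by apply: Or33; rewrite ifF //; lra.
Qed.

Lemma scherk_lattice_unit s1 s2 t1 t2 :
  scherk_lattice s1 s2 = scherk_lattice t1 t2 ->
  lattice (unitvec s1) (unitvec s2) =
    lattice (unitvec t1) (unitvec t2) :> set 'rV[R]_2.
Proof.
by apply: lattice_scale_eq; rewrite mulf_neq0 ?pnatr_eq0 // gt_eqF ?pi_gt0.
Qed.

Lemma scherk_lattice_two_directions s1 s2 t1 t2 :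
    lin_indep (unitvec s1) (unitvec s2 : 'rV[R]_2) ->
    ~ is_triangular (scherk_lattice s1 s2) ->
    scherk_lattice s1 s2 = scherk_lattice t1 t2 ->
  parallel (unitvec t1 : 'rV[R]_2) (unitvec s1) \/
  parallel (unitvec t1 : 'rV[R]_2) (unitvec s2).
Proof.
move=> indep ntri /scherk_lattice_unit.
case/(lattice_unit_basis (dotp_unitvec1 _) (dotp_unitvec1 _) indep
        (dotp_unitvec1 _)).
- by left.
- by right.
- by case=> c _; case: ntri; apply: scherk_lattice_triangular; left.
- by case=> c _; case: ntri; apply: scherk_lattice_triangular; right.
Qed.

End Rhombic.

(** * Alternation along an interval of indices *)

Lemma int_interval_ind (I : set int) (P : int -> Prop) (k0 : int) :
    (forall i j k : int, I i -> I k -> i <= j -> j <= k -> I j) ->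
    (forall k, I k -> I (k + 1) -> P k <-> P (k + 1)) ->
    I k0 -> P k0 -> forall k, I k -> P k.
Proof.
move=> hI step Ik0 Pk0.
have up (n : nat) : I (k0 + n%:Z) -> P (k0 + n%:Z).
  elim: n => [|n IHn] In1; first by rewrite addr0.
  have In : I (k0 + n%:Z) by apply: (hI k0 _ _ Ik0 In1); lia.
  have e : k0 + n.+1%:Z = (k0 + n%:Z) + 1 by lia.
  by rewrite e in In1 *; apply/(step _ In In1)/IHn.
have down (n : nat) : I (k0 - n%:Z) -> P (k0 - n%:Z).
  elim: n => [|n IHn] In1; first by rewrite subr0.
  have In : I (k0 - n%:Z) by apply: (hI _ _ k0 In1 Ik0); lia.
  have e : k0 - n%:Z = (k0 - n.+1%:Z) + 1 by lia.
  rewrite e in In IHn; exact/(step _ In1 In)/IHn.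
move=> k Ik; have [le|lt] := leP k0 k.
  have e : k = k0 + `|k - k0|%N%:Z by lia.
  by have := up `|k - k0|%N; rewrite -e; apply.
have e : k = k0 - `|k - k0|%N%:Z by lia.
by have := down `|k - k0|%N; rewrite -e; apply.
Qed.

(** Passing from [k] to [k + 1] exchanges the upward and the downward direction.
    The value of [W] at a parity [b] is the upward direction of the members of
    that parity, so the downward direction is its value at the other parity. *)
Lemma alternating_directions (R : realType) (I : set int)
    (up down : int -> 'rV[R]_2) :
    (forall i j k : int, I i -> I k -> i <= j -> j <= k -> I j) ->
    (forall k, I k -> I (k + 1) ->
       parallel (down (k + 1)) (up k) /\ parallel (up (k + 1)) (down k)) ->
    forall k0, I k0 -> lin_indep (up k0) (down k0) ->
  exists W : bool -> 'rV[R]_2, lin_indep (W false) (W true) /\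
    forall k, I k -> parallel (up k) (W (odd `|k|%N)) /\
                     parallel (down k) (W (~~ odd `|k|%N)).
Proof.
move=> hI step k0 Ik0 indep.
exists (fun b => if b == odd `|k0|%N then up k0 else down k0); split.
  by case: odd => //=; apply: lin_indep_sym.
apply: (int_interval_ind hI _ Ik0); last first.
  by rewrite eqxx; case: odd => /=; split; exact: parallel_refl.
move=> k Ik Ik1; have [du ud] := step k Ik Ik1.
have -> : odd `|(k + 1)%R|%N = ~~ odd `|k|%N by lia.
rewrite negbK; split=> -[hu hd]; split.
- exact: parallel_trans ud hd.
- exact: parallel_trans du hu.
- exact: parallel_trans (parallel_sym du) hd.
- exact: parallel_trans (parallel_sym ud) hu.
Qed.

(** * Directions of the limit planes *)

Theorem lemma2 (R : realType)
  (* the tori and the minimal surfaces *)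
  (Lam : R -> set 'rV[R]_2) (Sg : R -> topologicalType)
  (X : forall e : R, Sg e -> E3 R)
  (hLam : forall e : R, 0 < e -> is_lattice (Lam e))
  (hX : forall e : R, 0 < e -> minimal_surface (Lam e) (X e))
  (M := fun e : R => periodic_lift (Lam e) (X e))
  (hlim : forall H : R,
     (exists t1 t2 : R, scherk_limit Lam M H t1 t2) \/
     (exists d : 'rV[R]_2, planes_limit Lam M H d))
  (* the Scherk surfaces S_k, k in I, at heights h k, with upward ends parallel
     to unitvec (up k) and downward ends parallel to unitvec (down k) *)
  (I : set int) (h up down : int -> R)
  (hI : forall i j k : int, I i -> I k -> i <= j -> j <= k -> I j)
  (hh : forall i j : int, I i -> I j -> i < j -> h i < h j)
  (hS : forall k : int, I k -> scherk_limit Lam M (h k) (up k) (down k))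
  (hSall : forall H t1 t2 : R, scherk_limit Lam M H t1 t2 ->
     exists2 k : int, I k & H = h k)
  (hP : forall (k : int) (H : R) (d : 'rV[R]_2),
     between I h k H -> planes_limit Lam M H d ->
     (I k -> parallel d (unitvec (up k))) /\
     (I (k + 1) -> parallel d (unitvec (down (k + 1))))) :
  let to_triangular := exists L, is_triangular L /\ cvg_lattice Lam L in
  (to_triangular /\
   exists w0 w1 w2 : 'rV[R]_2,
     [/\ lin_indep w0 w1, lin_indep w0 w2, lin_indep w1 w2 &
       forall (k : int) (H : R) (d : 'rV[R]_2),
         between I h k H -> planes_limit Lam M H d ->
         [\/ parallel d w0, parallel d w1 | parallel d w2]])
  \/
  (~ to_triangular /\
   exists w0 w1 : 'rV[R]_2,
     lin_indep w0 w1 /\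
     forall (k : int) (H : R) (d : 'rV[R]_2),
       between I h k H -> planes_limit Lam M H d ->
       parallel d (if odd `|k|%N then w1 else w0)).
Proof.
move=> to_triangular.
have cvgL k : I k -> cvg_lattice Lam (scherk_lattice (up k) (down k)).
  by case/hS=> S _ [].
have indep k : I k -> lin_indep (unitvec (up k)) (unitvec (down k)).
  by case/hS=> S [].
have eqL j k : I j -> I k ->
    scherk_lattice (up j) (down j) = scherk_lattice (up k) (down k).
  by move=> Ij Ik; apply: cvg_lattice_unique (cvgL j Ij) (cvgL k Ik).
(* Strictly between two consecutive Scherk heights no Scherk surface occurs, so
   there is a pair of planes, and its direction is common to both neighbours. *)
have consecutive k : I k -> I (k + 1) ->
    parallel (unitvec (down (k + 1))) (unitvec (up k)).
  move=> Ik Ik1; have hk : h k < h (k + 1) by apply: hh => //; lia.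
  pose H := (h k + h (k + 1)) / 2.
  have kH : h k < H by rewrite /H; lra.
  have Hk : H < h (k + 1) by rewrite /H; lra.
  case: (hlim H) => [[t1 [t2 /hSall[j Ij Hj]]]|[d dH]].
    have lt i i' : I i -> I i' -> h i < h i' -> i < i'.
      move=> Ii Ii'; apply: contraTT; rewrite -!leNgt le_eqVlt.
      by case/predU1P=> [->|/hh hi] //; exact/ltW/hi.
    have kj : k < j by apply: lt; rewrite -?Hj.
    have jk : j < k + 1 by apply: lt; rewrite -?Hj.
    by lia.
  have betw : between I h k H by split=> //; left.
  have [du dd] := hP _ _ _ betw dH.
  exact: parallel_trans (parallel_sym (dd Ik1)) (du Ik).
have [[k0 Ik0]|I0] := pselect (exists k, I k); last first.
  have no_between k H : ~ between I h k H.
    by case=> -[Ik|Ik] _ _; apply: I0; [exists k | exists (k + 1)].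
  (* Without indices [between] never holds, so any independent vectors do. *)
  have indep0 : lin_indep (unitvec 0) (unitvec (pi / 2) : 'rV[R]_2).
    rewrite lin_indepE /wedge !mxE /= cos0 sin0 sin_pihalf mul1r mul0r subr0.
    exact: oner_neq0.
  have [r [ur dr _]] :=
    unit_basis_three_directions (dotp_unitvec1 _) (dotp_unitvec1 _) indep0.
  have [tri|ntri] := pselect to_triangular; [left|right]; split=> //.
    by exists (unitvec 0), (unitvec (pi / 2)), r; split=> // k H d /no_between.
  by exists (unitvec 0), (unitvec (pi / 2)); split=> // k H d /no_between.
have [tri|ntri] := pselect to_triangular; [left|right]; split=> //.
  have [r [ur dr three]] :=
    unit_basis_three_directions (dotp_unitvec1 _) (dotp_unitvec1 _)
      (indep _ Ik0).
  exists (unitvec (up k0)), (unitvec (down k0)), r; split=> //.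
    exact: indep.
  pose one_of_three w := [\/ parallel w (unitvec (up k0)),
    parallel w (unitvec (down k0)) | parallel w r].
  have inherit d w : parallel d w -> one_of_three w -> one_of_three d.
    move=> dw [e|e|e]; [apply: Or31|apply: Or32|apply: Or33];
      exact: parallel_trans dw e.
  move=> k H d betw dH; have [du dd] := hP _ _ _ betw dH.
  case: (betw) => -[Ik|Ik1] _ _.
    apply: inherit (du Ik) _; apply: three (dotp_unitvec1 _) _.
    exact: scherk_lattice_unit (eqL k0 k Ik0 Ik).
  apply: inherit (dd Ik1) _; apply: three (dotp_unitvec1 _) _.
  rewrite (scherk_lattice_unit (eqL _ _ Ik0 Ik1)); exact: latticeC.
have [|W [Windep hW]] := alternating_directions
  (up := fun k => unitvec (up k)) (down := fun k => unitvec (down k))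
  hI _ Ik0 (indep _ Ik0).
  move=> k Ik Ik1; split; first exact: consecutive.
  have ntriL : ~ is_triangular (scherk_lattice (up k) (down k)).
    move=> tri; apply: ntri; exists (scherk_lattice (up k) (down k)).
    by split=> //; exact: cvgL.
  case: (scherk_lattice_two_directions (indep k Ik) ntriL
           (eqL k (k + 1) Ik Ik1)) => // pu.
  case: (parallel_lin_dep _ (indep _ Ik1)).
  exact: parallel_trans pu (parallel_sym (consecutive k Ik Ik1)).
exists (W false), (W true); split=> //.
move=> k H d betw dH; have [du dd] := hP _ _ _ betw dH.
have -> : (if odd `|k|%N then W true else W false) = W (odd `|k|%N).
  by case: odd.
case: (betw) => -[Ik|Ik1] _ _.
  by apply: parallel_trans (du Ik) _; case: (hW k Ik).
apply: parallel_trans (dd Ik1) _; have [_] := hW _ Ik1.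
have -> : odd `|(k + 1)%R|%N = ~~ odd `|k|%N by lia.
by rewrite negbK.
Qed.
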